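(* (i) If $S$ is F-noetherian, then a skew-Laurent ring $S[x,x^{-1};f]$ may fail to be F-noetherian; that is, there exist an F-noetherian ring $S$ and an automorphism $f$ of $S$ such that $S[x,x^{-1};f]$ is not F-noetherian. (ii) Let $R=S[x,x^{-1};f]$ be a skew-Laurent ring extension such that for all $s\in S$, $f(s)=q_s s$ for some unit $q_s\in S$ fixed under the automorphism $f$. If $S$ is tightly F-noetherian, then $R$ is directed F-noetherian.
   Context: All rings have an identity $1$, and subrings contain $1$; ''noetherian'' means left and right noetherian. A ring $R$ is F-noetherian if every finite subset of $R$ is contained in a noetherian subring of $R$. It is tightly F-noetherian if every finite subset of $R$ generates (as a ring) a noetherian subring. It is directed F-noetherian if to every finite subset $X$ of $R$ one can assign a noetherian subring $R(X)$ of $R$ containing $X$ such that $X\subset Y$ implies $R(X)\subset R(Y)$ for finite subsets $X,Y$ of $R$. For a ring $S$ and a ring automorphism $f$ of $S$, the skew-Laurent ring $S[x,x^{-1};f]$ is the free left $S$-module with basis $\{x^m:m\in\mathbb{Z}\}$ and multiplication determined by $xs=f(s)x$ for $s\in S$. *)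

(* Defs.v *)
From mathcomp Require Import all_boot all_order all_algebra.
From mathcomp Require Import boolp classical_sets cardinality.

Set Implicit Arguments.
Unset Strict Implicit.
Unset Printing Implicit Defensive.

Import GRing.Theory.
Local Open Scope ring_scope.
Local Open Scope classical_set_scope.

(* Rings are unital, not necessarily commutative, and possibly zero, whence   *)
(* pzRingType throughout.                                                     *)

Section Noetherian.
Variable R : pzRingType.
Implicit Types A I X Y : set R.

Definition subring A : Prop := subring_closed [in A].

(* Left and right ideals of the subring A, as subsets of the ambient ring R;  *)
(* closure under opposites follows from -1 \in A.                             *)
Definition left_ideal A I : Prop :=
  [/\ I `<=` A, I 0, forall u v, I u -> I v -> I (u + v)
    & forall a u, A a -> I u -> I (a * u)].

Definition right_ideal A I : Prop :=
  [/\ I `<=` A, I 0, forall u v, I u -> I v -> I (u + v)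
    & forall a u, A a -> I u -> I (u * a)].

(* Ascending chain condition on the subsets satisfying P. *)
Definition acc (P : set R -> Prop) : Prop :=
  forall I : nat -> set R, (forall n, P (I n)) ->
    (forall m n, (m <= n)%N -> I m `<=` I n) ->
  exists N, forall n, (N <= n)%N -> I n = I N.

Definition noetherian_subring A : Prop :=
  [/\ subring A, acc (left_ideal A) & acc (right_ideal A)].

Definition F_noetherian : Prop :=
  forall X, finite_set X -> exists2 A, noetherian_subring A & X `<=` A.

Definition tightly_F_noetherian : Prop :=
  forall X, finite_set X -> noetherian_subring (smallest subring X).

(* The values of RX outside the finite subsets are irrelevant. *)
Definition directed_F_noetherian : Prop :=
  exists RX : set R -> set R,
    (forall X, finite_set X -> noetherian_subring (RX X) /\ X `<=` RX X) /\
    (forall X Y, finite_set X -> finite_set Y -> X `<=` Y -> RX X `<=` RX Y).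

Definition invertible (u : R) : Prop := exists v, u * v = 1 /\ v * u = 1.

(* The power x ^ m for m : int, where y is the inverse of x; exprz would      *)
(* require a unitRingType.                                                    *)
Definition zpow (x y : R) (m : int) : R :=
  match m with Posz n => x ^+ n | Negz n => y ^+ n.+1 end.

End Noetherian.

Arguments F_noetherian : clear implicits.
Arguments tightly_F_noetherian : clear implicits.
Arguments directed_F_noetherian : clear implicits.

(* R is the skew-Laurent ring S[x, x^-1; f], with y = x^-1 and with R a left  *)
(* S-module via iota : s * r := iota s * r. These conditions determine R up   *)
(* to a unique isomorphism over S preserving x. The injectivity of iota is    *)
(* the case ms = [:: 0] of skew_laurent_free.                                 *)
Record is_skew_laurent (S R : pzRingType) (f : {rmorphism S -> S})
    (iota : {rmorphism S -> R}) (x y : R) : Prop := IsSkewLaurent {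
  skew_laurent_xy : x * y = 1;
  skew_laurent_yx : y * x = 1;
  skew_laurent_comm : forall s, x * iota s = iota (f s) * x;
  skew_laurent_span : forall r, exists (ms : seq int) (c : int -> S),
    r = \sum_(m <- ms) iota (c m) * zpow x y m;
  skew_laurent_free : forall (ms : seq int) (c : int -> S), uniq ms ->
    \sum_(m <- ms) iota (c m) * zpow x y m = 0 ->
    forall m, m \in ms -> c m = 0
}.

(* Main.v *)
Require Import Defs.
From HB Require Import structures.
From mathcomp Require Import all_boot all_order all_algebra.
From mathcomp Require Import boolp classical_sets functions cardinality.

(** Failure for general skew-Laurent rings. Let [S] be the ring of all functions
    from the integers to the two-element field and [f] the shift. Every finite
    set of such functions lies in a finite subring, so [S] is F-noetherian
    ([bitstream_F_noetherian]). A subring [B] of [S[x, x^-1; f]] that contains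
    [x], [x^-1] and the indicator of 0 contains, by conjugation, the indicator
    of every integer. The skew-Laurent ring acts faithfully on [S], with [x]
    acting as [f], and the elements of [B] killing all functions that vanish at
    0, ..., n - 1 form a left ideal of [B]. These left ideals increase strictly with
    [n], because the indicator of [n] belongs to the next one only; hence [B] is
    not noetherian ([Laurent_not_F_noetherian]). Letting the skew-Laurent ring
    be a ring of operators gives its associativity for free, and the action on
    indicators shows that it is free over [S] ([Laurent_is_skew_laurent]).

    The eigenvalue hypothesis. Suppose that [f s = q_s * s] with units [q_s]
    fixed by [f]. To a finite set [X] attach the subring [B] of [S] generated by
    the coefficients [c] of its elements together with the [q_c] and their
    inverses. It is finitely generated, hence noetherian, and [f] maps it onto
    itself because it only rescales generators by units of [B]. So [B], [x] and
    [x^-1] generate a skew-Laurent extension of [B], which is noetherian by the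
    Hilbert basis theorem ([Laurent_noetherian]). Once a Laurent expression of
    each element of the ring and a [q_s] for each [s] have been chosen, this
    construction is monotone in [X] ([skew_Laurent_directed]).

    In the Hilbert basis theorem a left ideal is determined, within a larger one,
    by the left ideals of leading coefficients of its polynomial elements of each
    degree ([leading_coefs_inj]). A chain of left ideals thus gives a family of
    left ideals of the base ring that increases both with the index and with the
    degree, and such a double chain is stationary uniformly in the degree
    ([acc_double_chain]). *)

Set Implicit Arguments.
Unset Strict Implicit.
Unset Printing Implicit Defensive.

Import GRing.Theory.
Local Open Scope ring_scope.
Local Open Scope classical_set_scope.

Notation subring_gen := (smallest (@subring _)).

(** * Subrings and chain conditions *)

Section Subring.
Variable R : pzRingType.
Implicit Types A X : set R.

Lemma subringP A : subring A <->
  [/\ A 1, forall u v, A u -> A v -> A (u - v)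
         & forall u v, A u -> A v -> A (u * v)].
Proof.
split=> -[A1 AB AM]; split; first by rewrite inE in A1.
- by move=> u v Au Av; have := AB u v; rewrite !inE; apply.
- by move=> u v Au Av; have := AM u v; rewrite !inE; apply.
- by rewrite inE.
- by move=> u v; rewrite !inE; exact: AB.
- by move=> u v; rewrite !inE; exact: AM.
Qed.

Lemma subring1 A : subring A -> A 1.
Proof. by case/subringP. Qed.

Lemma subringM A u v : subring A -> A u -> A v -> A (u * v).
Proof. by case/subringP=> _ _; apply. Qed.

Lemma subring0 A : subring A -> A 0.
Proof. by case/subringP=> A1 AB _; rewrite -(subrr 1); apply: AB. Qed.

Lemma subringN A u : subring A -> A u -> A (- u).
Proof.
move=> sA Au; case/subringP: (sA) => _ AB _.
by rewrite -sub0r; apply: AB => //; apply: subring0.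
Qed.

Lemma subringD A u v : subring A -> A u -> A v -> A (u + v).
Proof.
move=> sA Au Av; case/subringP: (sA) => _ AB _.
by rewrite -[v]opprK; apply: AB => //; apply: subringN.
Qed.

Lemma subringX A u n : subring A -> A u -> A (u ^+ n).
Proof.
move=> sA Au; elim: n => [|n IHn]; first exact: subring1.
by rewrite exprS; apply: subringM.
Qed.

Lemma subring_smallest X : subring (subring_gen X).
Proof.
apply/subringP; split=> [|u v Xu Xv|u v Xu Xv] A [sA XA]; first exact: subring1.
- by apply: subringD => //; [apply: Xu | apply: subringN => //; apply: Xv].
- by apply: subringM => //; [apply: Xu | apply: Xv].
Qed.

End Subring.

Lemma subring_converse (R : pzRingType) :
  @subring R^c = @subring R :> (set R -> Prop).
Proof.
apply/funext => A; apply/propext.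
by split=> /subringP[A1 AB AM]; apply/subringP; split=> // u v Au Av; apply: AM.
Qed.

Lemma image_subring (S R : pzRingType) (h : {rmorphism S -> R}) (A : set S) :
  subring A -> subring (h @` A).
Proof.
move=> sA; apply/subringP; split; first by exists 1; [apply: subring1 | rewrite rmorph1].
- move=> _ _ [u Au <-] [v Av <-]; exists (u - v); last by rewrite rmorphB.
  by apply: subringD => //; apply: subringN.
- by move=> _ _ [u Au <-] [v Av <-]; exists (u * v); [apply: subringM | rewrite rmorphM].
Qed.

Lemma preimage_subring (S R : pzRingType) (h : {rmorphism S -> R}) (A : set R) :
  subring A -> subring (h @^-1` A).
Proof.
move=> sA; apply/subringP; split; first by rewrite /preimage /= rmorph1; apply: subring1.
- move=> u v Au Av; rewrite /preimage /= rmorphB.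
  by apply: subringD => //; apply: subringN.
- by move=> u v Au Av; rewrite /preimage /= rmorphM; apply: subringM.
Qed.

(** A chain stops growing as soon as its image under [F] does. This is used to
    transport the chain condition to the image of a subring, with [F] taking the
    preimages of ideals. *)
Lemma acc_pullback (S R : pzRingType) (P : set S -> Prop) (Q : set R -> Prop)
    (F : set R -> set S) :
    acc P -> (forall J, Q J -> P (F J)) ->
    (forall I J, I `<=` J -> F I `<=` F J) ->
    (forall I J, Q I -> Q J -> I `<=` J -> F I = F J -> I = J) ->
  acc Q.
Proof.
move=> accP QP Fmono Finj I QI Imono.
have [N FN] := accP (F \o I) (fun n => QP _ (QI n))
                    (fun m n le_mn => Fmono _ _ (Imono m n le_mn)).
by exists N => n leNn; apply/esym/Finj => //; [apply: Imono | exact: (esym (FN n leNn))].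
Qed.

Lemma image_noetherian (S R : pzRingType) (h : {rmorphism S -> R}) (A : set S) :
  noetherian_subring A -> noetherian_subring (h @` A).
Proof.
case=> sA accl accr.
have inj I J : I `<=` h @` A -> J `<=` h @` A ->
    A `&` h @^-1` I = A `&` h @^-1` J -> I = J.
  have sub U V : U `<=` h @` A -> A `&` h @^-1` U = A `&` h @^-1` V -> U `<=` V.
    by move=> UA UV u Uu; have [a Aa au] := UA u Uu; subst u;
       have: (A `&` h @^-1` U) a by []; rewrite UV => -[].
  by move=> IA JA IJ; apply/seteqP; split; apply: sub.
split; first exact: image_subring.
- apply: (@acc_pullback S R _ _ (fun I => A `&` h @^-1` I) accl) => [J|I J IJ|I J].
  + case=> JA J0 JD JM; split=> [u []//||u v [Au Ju] [Av Jv]|a u Aa [Au Ju]] //.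
    * by split; [apply: subring0 | rewrite /preimage /= rmorph0].
    * by split; [apply: subringD | rewrite /preimage /= rmorphD; apply: JD].
    * split; first exact: subringM.
      by rewrite /preimage /= rmorphM; apply: JM => //; exists a.
  + by apply: setIS => s; apply: IJ.
  + by case=> IA _ _ _ [JA _ _ _] _; apply: inj.
- apply: (@acc_pullback S R _ _ (fun I => A `&` h @^-1` I) accr) => [J|I J IJ|I J].
  + case=> JA J0 JD JM; split=> [u []//||u v [Au Ju] [Av Jv]|a u Aa [Au Ju]] //.
    * by split; [apply: subring0 | rewrite /preimage /= rmorph0].
    * by split; [apply: subringD | rewrite /preimage /= rmorphD; apply: JD].
    * split; first exact: subringM.
      by rewrite /preimage /= rmorphM; apply: JM => //; exists a.
  + by apply: setIS => s; apply: IJ.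
  + by case=> IA _ _ _ [JA _ _ _] _; apply: inj.
Qed.

(** The diagonal [L n n] settles at some [N0], which bounds all [L k n] with
    [k] and [n] at least [N0]; each of the finitely many remaining columns
    [n < N0] settles on its own. *)
Lemma acc_double_chain (R : pzRingType) (P : set R -> Prop)
    (L : nat -> nat -> set R) :
    acc P -> (forall k n, P (L k n)) ->
    (forall k l m n, (k <= l)%N -> (m <= n)%N -> L k m `<=` L l n) ->
  exists N, forall k n, (N <= k)%N -> L k n = L N n.
Proof.
move=> accP PL Lmono.
have [N0 diag] := accP (fun n => L n n) (fun n => PL n n)
                       (fun m n le_mn => Lmono m n m n le_mn le_mn).
have /choice[N col] n : exists N, forall k, (N <= k)%N -> L k n = L N n.
  exact: accP (fun k => L k n) (fun k => PL k n)
              (fun k l le_kl => Lmono k l n n le_kl (leqnn n)).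
exists (maxn N0 (\max_(n < N0) N n)) => k n; rewrite geq_max => /andP[leN0k leNk].
set M := maxn _ _.
have [ltn|le_n] := ltnP n N0.
  have le_Nn : (N n <= \max_(n < N0) N n)%N := leq_bigmax (Ordinal ltn).
  rewrite (col n k) ?(col n M) //; first by rewrite leq_max le_Nn orbT.
  exact: leq_trans le_Nn leNk.
have upto l : (N0 <= l)%N -> L l n = L N0 N0.
  move=> le_l; apply/seteqP; split; last exact: Lmono.
  rewrite -(diag (maxn l n)) ?leq_max ?le_l //.
  by apply: Lmono; rewrite ?leq_maxl ?leq_maxr.
by rewrite !upto // leq_maxl.
Qed.

(** A chain of subsets of a finite set is stationary: each of the finitely many
    elements, once it has entered the chain, stays. *)
Lemma acc_finite (R : pzRingType) (T : finType) (g : T -> R) (P : set R -> Prop) :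
  (forall I, P I -> I `<=` range g) -> acc P.
Proof.
move=> Pg I PI Imono.
have /choice[N NP] t : exists N, forall n, I n (g t) -> I N (g t).
  have [[n In]|nI] := pselect (exists n, I n (g t)); first by exists n.
  by exists 0 => n In; case: nI; exists n.
exists (\max_t N t) => n len; apply/seteqP; split; last exact: Imono.
move=> u Iu; have [t _ tu] := Pg _ (PI n) u Iu; subst u.
exact: Imono (leq_bigmax t) _ (NP t n Iu).
Qed.

(** * The Hilbert basis theorem for skew-Laurent extensions *)

Section LaurentLeft.
Variables (R : pzRingType) (A : set R) (x y : R).
Hypotheses (sA : subring A) (xy : x * y = 1) (yx : y * x = 1).
Hypothesis xAy : forall a, A a -> A (x * a * y).
Hypothesis yAx : forall a, A a -> A (y * a * x).

Let xyX n : x ^+ n * y ^+ n = 1.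
Proof.
elim: n => [|n IHn]; first by rewrite mulr1.
by rewrite exprSr exprS mulrA -(mulrA _ x) xy mulr1.
Qed.

Let yxX n : y ^+ n * x ^+ n = 1.
Proof.
elim: n => [|n IHn]; first by rewrite mulr1.
by rewrite exprSr exprS mulrA -(mulrA _ y) yx mulr1.
Qed.

Let xAyX n a : A a -> A (x ^+ n * a * y ^+ n).
Proof.
move=> Aa; elim: n => [|n IHn]; first by rewrite mulr1 mul1r.
by have := xAy IHn; rewrite exprS exprSr !mulrA.
Qed.

Let yAxX n a : A a -> A (y ^+ n * a * x ^+ n).
Proof.
move=> Aa; elim: n => [|n IHn]; first by rewrite mulr1 mul1r.
by have := yAx IHn; rewrite exprS exprSr !mulrA.
Qed.

(** Coefficients stand to the right of the powers of [x]: multiplying on the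
    left by elements of [A] then acts on the top coefficient through a twist,
    and multiplying by [x] leaves it unchanged. *)
Fixpoint skew_poly n : set R :=
  if n is m.+1 then [set p + x ^+ m * a | p in skew_poly m & a in A] else [set 0].

Lemma skew_poly0 n : skew_poly n 0.
Proof.
elim: n => //= n IHn; exists 0 => //; exists 0; first exact: subring0.
by rewrite mulr0 addr0.
Qed.

Lemma skew_polyD n p q : skew_poly n p -> skew_poly n q -> skew_poly n (p + q).
Proof.
elim: n p q => [|n IHn] p q /=; first by move=> -> ->; rewrite addr0.
case=> p' Pp' [a Aa <-] [q' Pq' [b Ab <-]]; exists (p' + q'); first exact: IHn.
by exists (a + b); [apply: subringD | rewrite mulrDr addrACA].
Qed.

Lemma skew_polyMr n p a : skew_poly n p -> A a -> skew_poly n (p * a).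
Proof.
move=> + Aa; elim: n p => [|n IHn] p /=; first by move=> ->; rewrite mul0r.
case=> q Pq [b Ab <-]; exists (q * a); first exact: IHn.
by exists (b * a); [apply: subringM | rewrite mulrDl mulrA].
Qed.

Lemma skew_polyN n p : skew_poly n p -> skew_poly n (- p).
Proof.
move=> Pp; rewrite -mulrN1; apply: skew_polyMr => //.
by apply: subringN => //; apply: subring1.
Qed.

Lemma skew_polyMl n p a : A a -> skew_poly n p -> skew_poly n (a * p).
Proof.
move=> Aa; elim: n p => [|n IHn] p /=; first by move=> ->; rewrite mulr0.
case=> q Pq [b Ab <-]; exists (a * q); first exact: IHn.
exists (y ^+ n * a * x ^+ n * b); first by apply: subringM => //; apply: yAxX.
by rewrite mulrDr !mulrA xyX mul1r.
Qed.

Lemma skew_polyS n p : skew_poly n p -> skew_poly n.+1 p.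
Proof.
move=> Pp; exists p => //; exists 0; first exact: subring0.
by rewrite mulr0 addr0.
Qed.

Lemma skew_poly_mono m n p : (m <= n)%N -> skew_poly m p -> skew_poly n p.
Proof.
move=> /subnKC <-; elim: (n - m)%N => [|k IHk] Pp; first by rewrite addn0.
by rewrite addnS; apply/skew_polyS/IHk.
Qed.

Lemma skew_poly_mulx n p : skew_poly n p -> skew_poly n.+1 (x * p).
Proof.
elim: n p => [|n IHn] p; first by move=> /= ->; rewrite mulr0; apply: (skew_poly0 1).
case=> q Pq [a Aa <-]; exists (x * q); first exact: IHn.
by exists a => //; rewrite mulrDr mulrA -exprS.
Qed.

Lemma skew_poly_mulxX k n p : skew_poly n p -> skew_poly (k + n) (x ^+ k * p).
Proof.
move=> Pp; elim: k => [|k IHk]; first by rewrite mul1r.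
by rewrite exprS -mulrA; apply: skew_poly_mulx.
Qed.

Lemma skew_polyM m n p q :
  skew_poly m p -> skew_poly n q -> skew_poly (m + n) (p * q).
Proof.
move=> + Pq; elim: m p => [|m IHm] p.
  by move=> /= ->; rewrite mul0r; apply: skew_poly0.
case=> p' Pp' [a Aa <-]; rewrite mulrDl; apply: skew_polyD.
  by rewrite addSn; apply/skew_polyS/IHm.
rewrite addSn -mulrA; apply/skew_polyS/skew_poly_mulxX.
exact: skew_polyMl.
Qed.

Lemma skew_poly_conj k n p :
  skew_poly n p -> skew_poly n (x ^+ k * p * y ^+ k).
Proof.
elim: n p => [|n IHn] p /=; first by move=> ->; rewrite mulr0 mul0r.
case=> q Pq [a Aa <-]; exists (x ^+ k * q * y ^+ k); first exact: IHn.
exists (x ^+ k * a * y ^+ k); first exact: xAyX.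
by rewrite mulrDr mulrDl !mulrA -!exprD addnC.
Qed.

Let T := subring_gen (A `|` [set x; y]).

Let sT : subring T. Proof. exact: subring_smallest. Qed.
Let TA : A `<=` T. Proof. by move=> a Aa; apply: sub_gen_smallest; left. Qed.
Let Tx : T x. Proof. by apply: sub_gen_smallest; right; left. Qed.
Let Ty : T y. Proof. by apply: sub_gen_smallest; right; right. Qed.

Lemma Laurent_clear_denominators r :
  T r -> exists m n, skew_poly n (x ^+ m * r).
Proof.
pose L := [set r | exists m n, skew_poly n (x ^+ m * r)].
suff [sL AL] : subring L /\ A `|` [set x; y] `<=` L.
  exact: (smallest_sub sL AL).
have P1 : skew_poly 1 1.
  by exists 0 => //; exists 1; [apply: subring1 | rewrite mulr1 add0r].
split; last first.
  move=> a [Aa|[->|->]].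
  - by exists 0, 1; rewrite mul1r -[a]mul1r; apply: skew_polyMr.
  - by exists 0, 2; rewrite mul1r -[x]mulr1; apply: skew_poly_mulx.
  - by exists 1, 1; rewrite expr1 xy.
apply/subringP; split; first by exists 0, 1; rewrite mulr1.
- move=> u v [m [n Pu]] [m' [n' Pv]]; exists (m + m')%N, (maxn (m' + n) (m + n')).
  rewrite mulrBr; apply: skew_polyD; last apply: skew_polyN.
  + rewrite (addnC m m') exprD -mulrA; apply: (skew_poly_mono (leq_maxl _ _)).
    exact: skew_poly_mulxX.
  + rewrite exprD -mulrA; apply: (skew_poly_mono (leq_maxr _ _)).
    exact: skew_poly_mulxX.
- move=> u v [m [n Pu]] [m' [n' Pv]]; exists (m' + m)%N, (n + n')%N.
  have := skew_polyM (skew_poly_conj m' Pu) Pv.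
  by rewrite !mulrA -(mulrA _ (y ^+ m')) yxX mulr1 -!mulrA !exprD -!mulrA.
Qed.

Definition leading_coefs (I : set R) n : set R :=
  [set a | A a /\ exists2 p, skew_poly n p & I (p + x ^+ n * a)].

(** An element of [A] has to be twisted by [x ^+ n] before it multiplies a
    polynomial of degree [n], so that the twists cancel at the top. *)
Lemma leading_coefs_ideal I n :
  left_ideal T I -> left_ideal A (leading_coefs I n).
Proof.
case=> IT I0 ID IM; split=> [a []//||a b|b a Ab].
- split; first exact: subring0.
  by exists 0; [apply: skew_poly0 | rewrite mulr0 addr0].
- case=> Aa [p Pp Ip] [Ab [q Pq Iq]]; split; first exact: subringD.
  exists (p + q); first exact: skew_polyD.
  by rewrite mulrDr addrACA; apply: ID.
- case=> Aa [p Pp Ip]; split; first exact: subringM.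
  have Ab' := xAyX n Ab.
  exists (x ^+ n * b * y ^+ n * p); first exact: skew_polyMl.
  have := IM _ _ (TA Ab') Ip.
  by rewrite mulrDr !mulrA -(mulrA _ (y ^+ n) (x ^+ n)) yxX mulr1.
Qed.

Lemma leading_coefs_mono I m n : left_ideal T I ->
  (m <= n)%N -> leading_coefs I m `<=` leading_coefs I n.
Proof.
case=> IT I0 ID IM /subnK <-; elim: (n - m)%N => [//|k IHk] a /IHk.
case=> Aa [p Pp Ip]; split=> //; exists (x * p); first exact: skew_poly_mulx.
by rewrite addSn exprS -mulrA -mulrDr; apply: IM.
Qed.

(** By induction on the degree: an element of [J] is corrected by an element
    of [I] with the same top term, leaving an element of [J] of lower degree. *)
Lemma leading_coefs_inj I J : left_ideal T I -> left_ideal T J -> I `<=` J ->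
  leading_coefs I = leading_coefs J -> I = J.
Proof.
case=> IT I0 ID IM [JT J0 JD JM] IJ lIJ; apply/seteqP; split=> // r Jr.
have polyI n p : skew_poly n p -> J p -> I p.
  elim: n p => [|n IHn] p; first by move=> /= ->.
  case=> p' Pp' [a Aa <-] Jp.
  have [_ [q Pq Iq]] : leading_coefs I n a by rewrite lIJ; split=> //; exists p'.
  have -> : p' + x ^+ n * a = (p' - q) + (q + x ^+ n * a) by rewrite addrA subrK.
  apply: (ID _ _ _ Iq); apply: IHn; first by apply/skew_polyD/skew_polyN.
  have -> : p' - q = (p' + x ^+ n * a) + - 1 * (q + x ^+ n * a).
    by rewrite mulN1r opprD addrACA subrr addr0.
  apply: JD => //; apply: JM; last exact: (IJ _ Iq).
  exact: subringN sT (subring1 sT).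
have [m [n Pr]] := Laurent_clear_denominators (JT r Jr).
have TX z k : T z -> T (z ^+ k) := @subringX _ _ _ k sT.
have Ixr : I (x ^+ m * r) by apply: (polyI n) => //; apply: JM => //; apply: TX.
by rewrite -[r]mul1r -(yxX m) -mulrA; apply: IM => //; apply: TX.
Qed.

Lemma acc_left_Laurent :
  acc (left_ideal A) -> acc (left_ideal (subring_gen (A `|` [set x; y]))).
Proof.
move=> accA I idI Imono.
have [|k l m n le_kl le_mn|N LN] :=
    @acc_double_chain R _ (fun k n => leading_coefs (I k) n) accA.
- by move=> k n; apply: leading_coefs_ideal.
- apply: (subset_trans (leading_coefs_mono (idI k) le_mn)) => a [Aa [p Pp Ip]].
  by split=> //; exists p => //; apply: (Imono k l).
exists N => n leNn; apply/esym/leading_coefs_inj => //; first exact: Imono.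
by apply/funext => d; rewrite (LN n d leNn).
Qed.

End LaurentLeft.

(** Right ideals are the left ideals of the converse ring, where the pair
    [x], [y] satisfies the same hypotheses and generates the same set. *)
Lemma Laurent_noetherian (R : pzRingType) (A : set R) (x y : R) :
    x * y = 1 -> y * x = 1 ->
    (forall a, A a -> A (x * a * y)) -> (forall a, A a -> A (y * a * x)) ->
  noetherian_subring A -> noetherian_subring (subring_gen (A `|` [set x; y])).
Proof.
move=> xy yx xAy yAx [sA accl accr]; split; first exact: subring_smallest.
  exact: acc_left_Laurent.
have sAc : @subring R^c A by rewrite subring_converse.
have mulc (u v : R) : (u : R^c) * v = v * u by [].
have := @acc_left_Laurent R^c A x y sAc yx xy.
rewrite subring_converse; apply=> // a Aa.
- by rewrite !mulc mulrA; apply: yAx.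
- by rewrite !mulc mulrA; apply: xAy.
Qed.

(** * Directed noetherian subrings of a skew-Laurent ring *)

Section Stable.
Variables (S : pzRingType) (f : {rmorphism S -> S}) (q qi : S -> S).
Hypotheses (qqi : forall s, q s * qi s = 1) (qiq : forall s, qi s * q s = 1).
Hypotheses (fq : forall s, f (q s) = q s) (fE : forall s, f s = q s * s).

(** The units [q c] and their inverses are among the generators so that both [f]
    and its inverse preserve the subring. *)
Definition stable_closure (C : set S) : set S :=
  subring_gen (C `|` q @` C `|` qi @` C).

Lemma f_qi s : f (qi s) = qi s.
Proof.
have q_fqi : q s * f (qi s) = 1 by rewrite -{1}fq -rmorphM qqi rmorph1.
by rewrite -[LHS]mul1r -(qiq s) -mulrA q_fqi mulr1.
Qed.

Lemma stable_closure_f C s : stable_closure C s -> stable_closure C (f s).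
Proof.
have sC : subring (stable_closure C) by apply: subring_smallest.
apply: (smallest_sub (preimage_subring f sC)) => c [[Cc|[{}c Cc <-]]|[{}c Cc <-]].
- rewrite /preimage /= fE; apply: (subringM sC); apply: sub_gen_smallest.
    by left; right; exists c.
  by left; left.
- by rewrite /preimage /= fq; apply: sub_gen_smallest; left; right; exists c.
- by rewrite /preimage /= f_qi; apply: sub_gen_smallest; right; exists c.
Qed.

(** On generators the preimages are explicit: [c] is the image of
    [qi c * c], while [q c] and [qi c] are fixed by [f]. *)
Lemma stable_closure_image C s :
  stable_closure C s -> exists2 t, stable_closure C t & f t = s.
Proof.
have sC : subring (stable_closure C) by apply: subring_smallest.
apply: (smallest_sub (image_subring f sC)) => c [[Cc|[{}c Cc <-]]|[{}c Cc <-]].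
- exists (qi c * c); last by rewrite rmorphM f_qi fE mulrA qiq mul1r.
  by apply: (subringM sC); apply: sub_gen_smallest; [right; exists c | left; left].
- by exists (q c); rewrite ?fq //; apply: sub_gen_smallest; left; right; exists c.
- by exists (qi c); rewrite ?f_qi //; apply: sub_gen_smallest; right; exists c.
Qed.

End Stable.

Lemma skew_Laurent_directed (S R : pzRingType) (f : {rmorphism S -> S})
    (iota : {rmorphism S -> R}) (x y : R) :
    is_skew_laurent f iota x y ->
    (forall s : S, exists q : S, invertible q /\ f q = q /\ f s = q * s) ->
  tightly_F_noetherian S -> directed_F_noetherian R.
Proof.
move=> [xy yx comm span _] eigen tight.
have /choice[u uP] s : exists w : S * S, [/\ w.1 * w.2 = 1, w.2 * w.1 = 1,
    f w.1 = w.1 & f s = w.1 * s].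
  by have [q [[qi [qqi qiq]] [fq fs]]] := eigen s; exists (q, qi).
pose q s := (u s).1; pose qi s := (u s).2.
have qqi s : q s * qi s = 1 by case: (uP s).
have qiq s : qi s * q s = 1 by case: (uP s).
have fq s : f (q s) = q s by case: (uP s).
have fE s : f s = q s * s by case: (uP s).
have /choice[w wP] r : exists w : seq int * (int -> S),
    r = \sum_(m <- w.1) iota (w.2 m) * zpow x y m.
  by have [ms [c rE]] := span r; exists (ms, c).
pose coefs (X : set R) := \bigcup_(r in X) ((w r).2 @` [set` (w r).1]).
pose B X := stable_closure q qi (coefs X).
exists (fun X => subring_gen ((iota @` B X) `|` [set x; y])); split.
  move=> X finX.
  have fin_coefs : finite_set (coefs X).
    by apply: bigcup_finite => // r _; apply: finite_image.
  have noethB : noetherian_subring (B X).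
    apply: tight; rewrite !finite_setU.
    by split; [split|]; rewrite //; apply: finite_image.
  split.
    apply: (Laurent_noetherian xy yx); last exact: image_noetherian.
    - move=> _ [s Bs <-]; rewrite comm -mulrA xy mulr1; exists (f s) => //.
      exact: stable_closure_f.
    - move=> _ [s /(stable_closure_image qqi qiq fq fE)[t Bt <-] <-].
      by rewrite -mulrA -comm mulrA yx mul1r; exists t.
  move=> r Xr; rewrite (wP r); set T := smallest _ _.
  have sT : subring T := subring_smallest _.
  have Tx : T x by apply: sub_gen_smallest; right; left.
  have Ty : T y by apply: sub_gen_smallest; right; right.
  rewrite big_seq; elim/big_ind: _ => [|a b Ta Tb|m m_r].
  - exact: (subring0 sT).
  - exact: (subringD sT).
  apply: (subringM sT); last first.
    by case: (m) => n; [apply: (subringX n sT Tx) | apply: (subringX n.+1 sT Ty)].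
  apply: sub_gen_smallest; left; exists ((w r).2 m) => //.
  by apply: sub_gen_smallest; left; left; exists r => //; exists m.
move=> X Y _ _ XY.
have CXY : coefs X `<=` coefs Y by apply: bigcup_subset.
apply: sub_smallest2r; first exact: subring_smallest.
apply/setSU/image_subset; rewrite /B /stable_closure.
apply: sub_smallest2r; first exact: subring_smallest.
by apply: setUSS; [apply: setUSS => //|]; apply: image_subset.
Qed.

(** * The shift on sequences over the two-element field *)

Definition bitstream := int -> bool.
HB.instance Definition _ := GRing.PzRing.copy bitstream (int -> bool).

Lemma bitstreamM (u v : bitstream) i : (u * v) i = u i && v i.
Proof. by []. Qed.

Definition shift (m : int) (v : bitstream) : bitstream := fun i => v (i - m).

Lemma shift_additive m : zmod_morphism (shift m).
Proof. by []. Qed.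

Lemma shift_multiplicative m : monoid_morphism (shift m).
Proof. by []. Qed.

HB.instance Definition _ m :=
  GRing.isZmodMorphism.Build bitstream bitstream (shift m) (shift_additive m).
HB.instance Definition _ m :=
  GRing.isMonoidMorphism.Build bitstream bitstream (shift m) (shift_multiplicative m).

Lemma shift0 : shift 0 = id.
Proof. by apply/funext => v; apply/funext => i; rewrite /shift subr0. Qed.

Lemma shiftD m n v : shift m (shift n v) = shift (m + n) v.
Proof. by apply/funext => i; rewrite /shift opprD addrA. Qed.

Lemma shift_bijective m : bijective (shift m).
Proof. by exists (shift (- m)) => v; rewrite shiftD ?addNr ?subrr shift0. Qed.

(** Finitely many streams cut the integers into finitely many classes, and the
    streams that are constant on the classes form a finite subring. *)
Lemma bitstream_F_noetherian : F_noetherian bitstream.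
Proof.
move=> X /finite_seqP[s ->{X}].
pose class i : (size s).-tuple bool := map_tuple (fun v : bitstream => v i) (in_tuple s).
pose g (h : {ffun (size s).-tuple bool -> bool}) : bitstream := fun i => h (class i).
exists (range g); last first.
  move=> v /= vs; exists [ffun t : (size s).-tuple bool => nth false t (index v s)] => //.
  apply/funext => i; rewrite /g ffunE /=.
  by rewrite (nth_map (0 : bitstream)) ?index_mem // nth_index.
split.
- apply/subringP; split.
  + by exists [ffun=> true] => //; apply/funext => i; rewrite /g ffunE.
  + move=> _ _ [h _ <-] [k _ <-]; exists [ffun t => h t - k t] => //.
    by apply/funext => i; rewrite /g ffunE.
  + move=> _ _ [h _ <-] [k _ <-]; exists [ffun t => h t * k t] => //.
    by apply/funext => i; rewrite /g ffunE.
- by apply: (@acc_finite _ _ g) => I [].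
- by apply: (@acc_finite _ _ g) => I [].
Qed.

(** * Its skew-Laurent ring, acting on sequences *)

(** The operator of the Laurent polynomial with the monomials [s], where [x]
    acts as [shift 1]; the action turns out to be faithful. *)
Definition Laurent_op (s : seq (bitstream * int)) (v : bitstream) : bitstream :=
  \sum_(p <- s) p.1 * shift p.2 v.

Definition is_Laurent_op : {pred bitstream -> bitstream} :=
  fun g => `[< exists s, g = Laurent_op s >].

Lemma Laurent_op1 c m v : Laurent_op [:: (c, m)] v = c * shift m v.
Proof. by rewrite /Laurent_op big_seq1. Qed.

Lemma Laurent_opB s u v : Laurent_op s (u - v) = Laurent_op s u - Laurent_op s v.
Proof.
by rewrite /Laurent_op -sumrB; apply: eq_bigr => p _; rewrite raddfB mulrBr.
Qed.

Lemma Laurent_op_zmod_closed : zmod_closed is_Laurent_op.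
Proof.
split=> [|_ _ /asboolP[s ->] /asboolP[t ->]]; apply/asboolP.
  by exists [::]; apply/funext => v; rewrite /Laurent_op big_nil.
exists (s ++ [seq (- p.1, p.2) | p <- t]); apply/funext => v.
rewrite /Laurent_op big_cat big_map /= -[X in _ = _ + X]opprK -sumrN.
by congr (_ - _); apply: eq_bigr => p _; rewrite mulNr opprK.
Qed.

Lemma Laurent_op_one : id \in is_Laurent_op.
Proof.
apply/asboolP; exists [:: (1, 0)]; apply/funext => v.
by rewrite Laurent_op1 shift0 mul1r.
Qed.

Lemma Laurent_op_comp g h :
  g \in is_Laurent_op -> h \in is_Laurent_op -> g \o h \in is_Laurent_op.
Proof.
move=> /asboolP[s ->] /asboolP[t ->]; apply/asboolP.
exists [seq (p.1 * shift p.2 r.1, p.2 + r.2) | p <- s, r <- t].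
apply/funext => v; rewrite /Laurent_op /= big_allpairs_dep.
apply: eq_bigr => p _; rewrite raddf_sum mulr_sumr; apply: eq_bigr => r _ /=.
by rewrite rmorphM /= shiftD mulrA.
Qed.

HB.instance Definition _ := GRing.isZmodClosed.Build (bitstream -> bitstream)
  is_Laurent_op Laurent_op_zmod_closed.

Record Laurent := MkLaurent {
  Laurent_val :> bitstream -> bitstream;
  Laurent_valP : Laurent_val \in is_Laurent_op }.

HB.instance Definition _ := [isSub for Laurent_val].
HB.instance Definition _ := [Choice of Laurent by <:].
HB.instance Definition _ := [SubChoice_isSubZmodule of Laurent by <:].

Implicit Types r : Laurent.

Lemma LaurentB r u v : r (u - v) = r u - r v.
Proof. by case: r => g /= /asboolP[s ->]; apply: Laurent_opB. Qed.

HB.instance Definition _ r :=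
  GRing.isZmodMorphism.Build bitstream bitstream r (LaurentB r).

Definition Laurent_one := MkLaurent Laurent_op_one.
Definition Laurent_mul r1 r2 :=
  MkLaurent (Laurent_op_comp (Laurent_valP r1) (Laurent_valP r2)).

Fact Laurent_mulA : associative Laurent_mul.
Proof. by move=> r1 r2 r3; apply: val_inj. Qed.

Fact Laurent_mul1r : left_id Laurent_one Laurent_mul.
Proof. by move=> r; apply: val_inj. Qed.

Fact Laurent_mulr1 : right_id Laurent_one Laurent_mul.
Proof. by move=> r; apply: val_inj. Qed.

Fact Laurent_mulDl : left_distributive Laurent_mul +%R.
Proof. by move=> r1 r2 r3; apply: val_inj. Qed.

Fact Laurent_mulDr : right_distributive Laurent_mul +%R.
Proof. by move=> r1 r2 r3; apply: val_inj; apply/funext => v /=; apply: raddfD. Qed.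

HB.instance Definition _ := GRing.Zmodule_isPzRing.Build Laurent
  Laurent_mulA Laurent_mul1r Laurent_mulr1 Laurent_mulDl Laurent_mulDr.

Lemma is_monomial c m : (fun v => c * shift m v) \in is_Laurent_op.
Proof.
by apply/asboolP; exists [:: (c, m)]; apply/funext => v; rewrite Laurent_op1.
Qed.

Definition monomial c m : Laurent := MkLaurent (is_monomial c m).

Lemma LaurentP r1 r2 : (forall v, r1 v = r2 v) -> r1 = r2.
Proof. by move=> r12; apply/val_inj/funext. Qed.

Lemma LaurentM r1 r2 v : (r1 * r2) v = r1 (r2 v).
Proof. by []. Qed.

Lemma Laurent_sum I (s : seq I) (F : I -> Laurent) v :
  (\sum_(i <- s) F i) v = \sum_(i <- s) F i v.
Proof. by elim/big_rec2: _ => // i a b _ <-. Qed.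

Definition scalar c : Laurent := monomial c 0.

Lemma scalarE c v : scalar c v = c * v.
Proof. by rewrite /= shift0. Qed.

Lemma scalar_additive : zmod_morphism scalar.
Proof. by move=> c d; apply: LaurentP => v; rewrite /= mulrBl. Qed.

Lemma scalar_multiplicative : monoid_morphism scalar.
Proof.
split=> [|c d]; apply: LaurentP => v; first by rewrite scalarE mul1r.
by rewrite LaurentM !scalarE mulrA.
Qed.

HB.instance Definition _ :=
  GRing.isZmodMorphism.Build bitstream Laurent scalar scalar_additive.
HB.instance Definition _ :=
  GRing.isMonoidMorphism.Build bitstream Laurent scalar scalar_multiplicative.

Definition Laurent_x := monomial 1 1.
Definition Laurent_y := monomial 1 (- 1).

Lemma zpowE m v : zpow Laurent_x Laurent_y m v = shift m v.
Proof.
have xE w : Laurent_x w = shift 1 w by rewrite /= mul1r.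
have yE w : Laurent_y w = shift (- 1) w by rewrite /= mul1r.
case: m => n /=.
  elim: n v => [|n IHn] v; first by rewrite shift0.
  by rewrite exprS LaurentM xE IHn shiftD -intS.
elim: n v => [|n IHn] v; first by rewrite expr1 yE.
by rewrite exprS LaurentM yE IHn shiftD !NegzE -opprD -intS.
Qed.

Definition delta (n : int) : bitstream := fun i => i == n.

(** Freeness is read off from the action on the streams with one bit. *)
Lemma Laurent_is_skew_laurent :
  is_skew_laurent (shift 1) scalar Laurent_x Laurent_y.
Proof.
have opE ms c v :
    (\sum_(m <- ms) scalar (c m) * zpow Laurent_x Laurent_y m) v =
    \sum_(m <- ms) c m * shift m v.
  by rewrite Laurent_sum; apply: eq_bigr => m _; rewrite LaurentM scalarE zpowE.
split.
- by apply: LaurentP => v; rewrite LaurentM /= !mul1r shiftD subrr shift0.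
- by apply: LaurentP => v; rewrite LaurentM /= !mul1r shiftD addNr shift0.
- by move=> s; apply: LaurentP => v; rewrite !LaurentM !scalarE /= !mul1r rmorphM.
- move=> r; have /asboolP[s rE] := Laurent_valP r.
  (* A list of monomials may repeat an exponent: like terms are collected. *)
  exists (undup (map snd s)), (fun m => \sum_(p <- s | p.2 == m) p.1).
  apply: LaurentP => v; rewrite opE rE /Laurent_op.
  under [RHS]eq_bigr do rewrite mulr_suml.
  rewrite (exchange_big_dep xpredT) //= big_seq [RHS]big_seq.
  apply: eq_bigr => p ps; rewrite -big_filter.
  have -> : [seq m <- undup (map snd s) | p.2 == m] = [:: p.2].
    apply: perm_small_eq => //.
    rewrite -(eq_filter (a1 := pred1 p.2)); last by move=> m; rewrite /= eq_sym.
    by rewrite filter_pred1_uniq ?undup_uniq // mem_undup map_f.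
  by rewrite big_seq1.
- move=> ms c uniq_ms sum0 m m_ms; apply/funext => i.
  have := congr1 (fun r : Laurent => r (delta (i - m)) i) sum0.
  rewrite opE fct_sumE (bigD1_seq m) //= big1 => [|k km].
    by rewrite addr0 bitstreamM /shift /delta eqxx andbT.
  rewrite bitstreamM /shift /delta (inj_eq (addrI i)) eqr_opp.
  by rewrite (negPf km) andbF.
Qed.

(** Defined as an annihilator, this set is a left ideal at once, and grows with
    [n] because the condition then bears on fewer streams. *)
Definition annihilators (B : set Laurent) (n : nat) : set Laurent :=
  [set r | B r /\ forall v : bitstream, (forall i : nat, (i < n)%N -> ~~ v i) -> r v = 0].

Lemma annihilators_ideal B n : subring B -> left_ideal B (annihilators B n).
Proof.
move=> sB; split=> [r []//||r1 r2 [B1 ann1] [B2 ann2]|r1 r2 B1 [B2 ann2]].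
- by split; [apply: subring0 | ].
- split; first exact: subringD.
  by move=> v v0; rewrite -[LHS]/(r1 v + r2 v) ann1 // ann2 // addr0.
- split; first exact: subringM.
  by move=> v v0; rewrite LaurentM ann2 // raddf0.
Qed.

Lemma annihilators_mono B m n : (m <= n)%N -> annihilators B m `<=` annihilators B n.
Proof.
move=> le_mn r [Br ann]; split=> // v v0; apply: ann => i lt_im.
by apply: v0; apply: leq_trans le_mn.
Qed.

(** A subring containing [x], [y] and [delta 0] contains the conjugates
    [delta n] of [delta 0] by the powers of [x]; and [delta n] annihilates the streams vanishing at 0, ..., n,
    but not itself. *)
Lemma Laurent_not_F_noetherian : ~ F_noetherian Laurent.
Proof.
move=> /(_ [set Laurent_x; Laurent_y; scalar (delta 0)]).
case=> [|B [sB accl _] XB].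
  by rewrite !finite_setU; split; [split|]; apply: finite_set1.
have Bx : B Laurent_x by apply: XB; left; left.
have By : B Laurent_y by apply: XB; left; right.
have [xy _ comm _ _] := Laurent_is_skew_laurent.
have Bdelta (n : nat) : B (scalar (delta n)).
  elim: n => [|n IHn]; first by apply: XB; right.
  have -> : delta n.+1 = shift 1 (delta n).
    by apply/funext => i; rewrite /shift /delta subr_eq intS addrC.
  rewrite -[scalar _]mulr1 -xy mulrA -comm.
  by apply: subringM => //; apply: subringM.
have [N stable] := accl (annihilators B) (fun n => annihilators_ideal n sB)
                        (@annihilators_mono B).
have : annihilators B N (scalar (delta N)).
  rewrite -(stable N.+1) //; split=> // v v0; rewrite scalarE.
  apply/funext => i; rewrite bitstreamM /delta; case: eqP => //= ->.
  exact/negbTE/v0.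
case=> _ /(_ (delta N)) ann.
have /(congr1 (fun v : bitstream => v N)) : scalar (delta N) (delta N) = 0.
  by apply: ann => i lt_iN; rewrite /delta eqz_nat ltn_eqF.
by rewrite scalarE bitstreamM /delta eqxx.
Qed.

Theorem mainTheorem14 :
  (exists (S : pzRingType) (f : {rmorphism S -> S}),
     F_noetherian S /\ bijective f /\
     exists (R : pzRingType) (iota : {rmorphism S -> R}) (x y : R),
       is_skew_laurent f iota x y /\ ~ F_noetherian R) /\
  (forall (S R : pzRingType) (f : {rmorphism S -> S})
          (iota : {rmorphism S -> R}) (x y : R),
     bijective f -> is_skew_laurent f iota x y ->
     (forall s : S, exists q : S,
        invertible q /\ f q = q /\ f s = q * s) ->
     tightly_F_noetherian S -> directed_F_noetherian R).
Proof.
split; last first.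
  by move=> S R f iota x y _; exact: skew_Laurent_directed.
exists bitstream, (shift 1); split; first exact: bitstream_F_noetherian.
split; first exact: shift_bijective.
exists Laurent, scalar, Laurent_x, Laurent_y; split.
  exact: Laurent_is_skew_laurent.
exact: Laurent_not_F_noetherian.
Qed.
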